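(* If $|q|<1$ and $a\neq -q^{-2N}$ for any integer $N>0$, then $$\sum_{n=0}^{\infty}\frac{a^nq^{n^2+n}}{(q;q)_n}=(-aq^2;q^2)_{\infty}\sum_{n=0}^{\infty}\frac{a^nq^{n^2+2n}}{(q^2;q^2)_n(-aq^2;q^2)_n}=(-aq^3;q^2)_{\infty}\sum_{n=0}^{\infty}\frac{a^nq^{n^2+n}}{(q^2;q^2)_n(-aq^3;q^2)_n}.$$
   Context: Here $a$ and $q$ are complex numbers. Notation: $(x;q)_0=1$, $(x;q)_n=\prod_{j=0}^{n-1}(1-xq^{j})$ for $n\ge 1$, and $(x;q)_\infty=\prod_{j=0}^{\infty}(1-xq^{j})$ (and likewise with base $q^2$ in place of $q$).
   Formalization: The last equality is stated only when (-aq^3;q^2)_n is nonzero for all n; for a = -q^{-(2N+1)} with N>0 (e.g. q=1/2, a=-8) the third expression has zero denominators. For q=0 the condition on a excludes nothing. *)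

(* Defs.v *)
From Stdlib Require Export Reals.
From Coquelicot Require Export Coquelicot.

Local Open Scope C_scope.

(* The finite q-shifted factorial (x; q)_n = prod_(j < n) (1 - x q^j). *)
Fixpoint qpoch (x q : C) (n : nat) : C :=
  match n with
  | O => 1
  | S k => qpoch x q k * (1 - x * q ^ k)
  end.

(* (x; q)_oo = l.  Only convergence of the partial products is asked for; a
   limit equal to 0 is allowed. *)
Definition is_qpoch_inf (x q l : C) : Prop :=
  filterlim (qpoch x q) eventually (locally l).

(* Main.v *)
(** Write [F x] for the left-hand series at [a = x], and [G x], [H x] for the two
    right-hand sides, with the infinite product moved inside the sum so that the
    [n]-th terms carry [(-x q^(2n+2); q^2)_oo] and [(-x q^(2n+3); q^2)_oo].
    Comparing terms gives
      [F x = F (x q) + x q^2 F (x q^2)],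
      [G x = H (x q) + x q^2 G (x q^2)],
      [H x = G (x q) + x q^2 H (x q^2)],
    and all three functions tend to [1] as [x] tends to [0].  Hence
    [W k = |F - G| + |F - H|] at [x = a q^k] tends to [0] and satisfies
    [W k <= W (k+1) + c |q|^k W (k+2)], which forces [W 0 = 0]. *)

Require Import Defs.
From Stdlib Require Import Reals Lra Lia.
From Coquelicot Require Import Coquelicot.

Local Open Scope C_scope.

(** * Complex series: comparison, linear combination, index shift, limits as values *)

Lemma exp_le (x y : R) : (x <= y)%R -> (exp x <= exp y)%R.
Proof.
intros [H|H].
- left. now apply exp_increasing.
- rewrite H. apply Rle_refl.
Qed.

Lemma is_series_Cmod_le (f : nat -> C) (g : nat -> R) (l : C) (m : R) :
  (forall n, (Cmod (f n) <= g n)%R) -> is_series f l -> is_series g m ->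
  (Cmod l <= m)%R.
Proof.
intros Hfg Hf Hg.
assert (Hn : is_lim_seq (fun n => Cmod (sum_n f n)) (Cmod l)).
{ exact (filterlim_comp _ _ _ _ _ _ _ _ Hf (@filterlim_norm _ C_NormedModule l)). }
refine (is_lim_seq_le _ (sum_n g) (Cmod l) m _ Hn Hg).
intro n.
apply Rle_trans with (sum_n (fun k => Cmod (f k)) n).
- exact (norm_sum_n_m (V := C_NormedModule) f 0 n).
- apply sum_n_m_le. exact Hfg.
Qed.

Lemma is_series_unique_C (f : nat -> C) (l m : C) :
  is_series f l -> is_series f m -> l = m.
Proof. intros H1 H2. exact (filterlim_locally_unique _ _ _ H1 H2). Qed.

Lemma is_series_Cplus_Cscal (f g h : nat -> C) (A B D c : C) :
  (forall n, f n = g n + c * h n) ->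
  is_series f A -> is_series g B -> is_series h D -> A = B + c * D.
Proof.
intros E HA HB HD.
apply (is_series_unique_C f); trivial.
apply (is_series_ext (fun n => plus (g n) (scal c (h n)))).
- intro n. rewrite E. reflexivity.
- exact (is_series_plus _ _ _ _ HB (is_series_scal c _ _ HD)).
Qed.

(** Removing the common zeroth term reduces this to the unshifted case. It serves recurrences in
    which the term of index [S n] splits off a multiple of the term of index [n] of another
    series. *)
Lemma is_series_Cplus_Cscal_shift (f g h : nat -> C) (A B D c : C) :
  f 0%nat = g 0%nat -> (forall n, f (S n) = g (S n) + c * h n) ->
  is_series f A -> is_series g B -> is_series h D -> A = B + c * D.
Proof.
intros E0 E HA HB HD.
assert (X : A - f 0%nat = (B - g 0%nat) + c * D).
{ apply (is_series_Cplus_Cscal (fun n => f (S n)) (fun n => g (S n)) h); trivial;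
    apply is_series_incr_1.
  - replace (plus _ _) with A; trivial. change (A = A - f 0%nat + f 0%nat). ring.
  - replace (plus _ _) with B; trivial. change (B = B - g 0%nat + g 0%nat). ring. }
replace A with (A - f 0%nat + f 0%nat) by ring.
rewrite X, E0. ring.
Qed.

Lemma is_series_head_Cmod_le (f : nat -> C) (g : nat -> R) (l : C) (m : R) :
  (forall n, (Cmod (f (S n)) <= g n)%R) -> is_series f l -> is_series g m ->
  (Cmod (l - f 0%nat) <= m)%R.
Proof.
intros Hfg Hf Hg.
apply (is_series_Cmod_le (fun n => f (S n)) g); trivial.
apply is_series_incr_1.
replace (plus _ _) with l; trivial. change (l = l - f 0%nat + f 0%nat). ring.
Qed.

(** A total operator, so that infinite products and sums become functions of their argument; its
    value is meaningful only for convergent [u]. *)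
Definition Clim (u : nat -> C) : C :=
  lim (T := C_CompleteNormedModule) (filtermap u eventually).

Lemma Clim_correct (u : nat -> C) :
  (exists l : C, filterlim u eventually (locally l)) ->
  filterlim u eventually (locally (Clim u)).
Proof.
intros [l Hl].
apply (filterlim_locally (U := C_CompleteNormedModule)). intro eps.
apply (complete_cauchy (T := C_CompleteNormedModule) (filtermap u eventually)).
- apply filtermap_proper_filter. apply eventually_filter.
- intros e. exists l.
  apply (proj1 (filterlim_locally (U := C_CompleteNormedModule) u l) Hl e).
Qed.

Definition Cseries (f : nat -> C) : C := Clim (sum_n f).

Lemma Cseries_correct (f : nat -> C) : ex_series f -> is_series f (Cseries f).
Proof. exact (Clim_correct (sum_n f)). Qed.

Lemma ex_series_Cmod_le (f : nat -> C) (g : nat -> R) :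
  (forall n, (Cmod (f n) <= g n)%R) -> ex_series g -> ex_series f.
Proof. exact (ex_series_le (V := C_CompleteNormedModule) f g). Qed.

Lemma Cmod_le_sum_n (u : nat -> C) (N n : nat) :
  (n <= N)%nat -> (Cmod (u n) <= sum_n (fun k => Cmod (u k)) N)%R.
Proof.
induction N as [|N IH]; intro H.
- replace n with 0%nat by lia. rewrite sum_O. lra.
- rewrite sum_Sn. change (plus ?x ?y) with (x + y)%R.
  destruct (Nat.eq_dec n (S N)) as [->|Hn].
  + enough (0 <= sum_n (fun k => Cmod (u k)) N)%R by lra.
    rewrite <- (Rmult_0_r (INR (S N))). rewrite <- sum_n_const.
    apply sum_n_m_le. intro k. apply Cmod_ge_0.
  + specialize (IH ltac:(lia)). generalize (Cmod_ge_0 (u (S N))). lra.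
Qed.

Lemma eventually_mul_pow_le (A r e : R) :
  (0 <= r < 1)%R -> (0 < e)%R ->
  exists N, forall n, (N <= n)%nat -> (Rabs (A * r ^ n) <= e)%R.
Proof.
intros Hr He.
assert (H : is_lim_seq (fun n => A * r ^ n)%R 0).
{ replace (Finite 0) with (Rbar_mult A 0) by (simpl; f_equal; ring).
  apply is_lim_seq_scal_l. apply is_lim_seq_geom. rewrite Rabs_pos_eq; lra. }
apply is_lim_seq_spec in H.
destruct (H (mkposreal e He)) as [N HN].
exists N. intros n Hn. specialize (HN n Hn). simpl in HN.
rewrite Rminus_0_r in HN. lra.
Qed.

(** The term equals [(A * r ^ n) ^ n], and [A * r ^ n] is eventually at most [1/2], so the tail is
    dominated by a geometric series. *)
Lemma ex_series_pow_mul_pow_sqr (A r : R) :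
  (0 <= A)%R -> (0 <= r < 1)%R -> ex_series (fun n => A ^ n * r ^ (n ^ 2))%R.
Proof.
intros HA Hr.
destruct (eventually_mul_pow_le A r (/ 2) Hr ltac:(lra)) as [N HN].
apply (ex_series_incr_n _ N).
apply (ex_series_le (V := R_CompleteNormedModule) _ (fun n => (/ 2) ^ n)%R).
- intro n. change (norm ?x) with (Rabs x).
  replace (A ^ (N + n) * r ^ ((N + n) ^ 2))%R with ((A * r ^ (N + n)) ^ (N + n))%R.
  + rewrite <- RPow_abs.
    apply Rle_trans with ((/ 2) ^ (N + n))%R.
    * apply pow_incr. split; [apply Rabs_pos | apply HN; lia].
    * rewrite pow_add. rewrite <- (Rmult_1_l ((/2) ^ n)) at 2.
      apply Rmult_le_compat_r; [apply pow_le; lra|].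
      rewrite <- (pow1 N). apply pow_incr. lra.
  + rewrite Rpow_mult_distr, <- pow_mult. do 2 f_equal. simpl. lia.
- apply ex_series_geom. rewrite Rabs_pos_eq; lra.
Qed.

(** * The q-shifted factorial: bounds, infinite product, splitting *)

Lemma qpoch_S (x p : C) (n : nat) :
  qpoch x p (S n) = qpoch x p n * (1 - x * p ^ n).
Proof. reflexivity. Qed.

Section QPochhammer.

Variable p : C.
Hypothesis Hp : (Cmod p < 1)%R.

Let r := Cmod p.

(** Once [|x| r^n <= 1/2], every new factor has modulus at least [1/2], so its inverse costs at most
    a factor 2; the finitely many earlier inverses are absorbed in [M]. Growth like [2 ^ n] is
    harmless next to [q ^ (n ^ 2)]. *)
Lemma Cinv_qpoch_le (x : C) :
  (forall n, qpoch x p n <> 0) ->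
  exists M, forall n, (Cmod (/ qpoch x p n) <= M * 2 ^ n)%R.
Proof.
intro H0.
pose proof (Cmod_ge_0 p) as Hp0.
destruct (eventually_mul_pow_le (Cmod x) r (/ 2)) as [N HN]; [unfold r; lra | lra |].
set (M := sum_n (fun k => Cmod (/ qpoch x p k)) N).
assert (HM : forall n, (n <= N)%nat -> (Cmod (/ qpoch x p n) <= M)%R).
{ apply (Cmod_le_sum_n (fun k => / qpoch x p k)). }
assert (HM0 : (0 <= M)%R).
{ generalize (HM 0%nat ltac:(lia)) (Cmod_ge_0 (/ qpoch x p 0)). lra. }
exists M. intro n. induction n as [|n IH].
- rewrite Rmult_1_r. apply HM. lia.
- destruct (Nat.le_gt_cases (S n) N) as [Hn|Hn].
  + apply Rle_trans with M; [now apply HM|].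
    rewrite <- (Rmult_1_r M) at 1. apply Rmult_le_compat_l; trivial.
    apply pow_R1_Rle. lra.
  + pose proof (H0 (S n)) as HS. simpl in HS |- *.
    assert (Hf : 1 - x * p ^ n <> 0).
    { intro E. apply HS. rewrite E. ring. }
    rewrite (Cmod_inv _ HS), Cmod_mult.
    rewrite (Cmod_inv _ (H0 n)) in IH.
    pose proof (proj1 (Cmod_gt_0 _) (H0 n)) as H1.
    assert (H2 : (/ 2 <= Cmod (1 - x * p ^ n))%R).
    { specialize (HN n ltac:(lia)).
      rewrite Rabs_pos_eq in HN
        by (apply Rmult_le_pos; [apply Cmod_ge_0 | apply pow_le; exact Hp0]).
      generalize (Cmod_triangle (1 - x * p ^ n) (x * p ^ n)).
      replace (1 - x * p ^ n + x * p ^ n) with (RtoC 1) by ring.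
      rewrite Cmod_1, Cmod_mult, Cmod_pow. fold r. lra. }
    rewrite Rinv_mult.
    replace (M * (2 * 2 ^ n))%R with (M * 2 ^ n * 2)%R by ring.
    apply Rmult_le_compat; trivial.
    * left. now apply Rinv_0_lt_compat.
    * left. apply Rinv_0_lt_compat. lra.
    * rewrite <- (Rinv_inv 2). apply Rinv_le_contravar; lra.
Qed.

(** Each factor is at most [1 + |x| r^j <= exp (|x| r^j)]; the exponent is [|x|] times the partial
    geometric sum. *)
Lemma Cmod_qpoch_le (x : C) (n : nat) :
  (Cmod (qpoch x p n) <= exp (Cmod x / (1 - r) * (1 - r ^ n)))%R.
Proof.
induction n as [|n IH]; simpl.
- rewrite Cmod_1, Rminus_diag, Rmult_0_r, exp_0. lra.
- rewrite Cmod_mult.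
  replace (Cmod x / (1 - r) * (1 - r * r ^ n))%R
    with (Cmod x / (1 - r) * (1 - r ^ n) + Cmod x * r ^ n)%R by (field; unfold r; lra).
  rewrite exp_plus.
  apply Rmult_le_compat; trivial; try apply Cmod_ge_0.
  apply Rle_trans with (1 + Cmod x * r ^ n)%R; [|apply exp_ineq1_le].
  eapply Rle_trans; [apply Cmod_triangle|].
  rewrite Cmod_opp, Cmod_1, Cmod_mult, Cmod_pow. apply Rle_refl.
Qed.

Lemma Cmod_qpoch_bound (x : C) (n : nat) :
  (Cmod (qpoch x p n) <= exp (Cmod x / (1 - r)))%R.
Proof.
eapply Rle_trans; [apply Cmod_qpoch_le|].
apply exp_le.
rewrite <- (Rmult_1_r (Cmod x / (1 - r))) at 2.
apply Rmult_le_compat_l.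
- apply Rdiv_le_0_compat; [apply Cmod_ge_0 | unfold r; lra].
- enough (0 <= r ^ n)%R by lra. apply pow_le, Cmod_ge_0.
Qed.

Definition qpoch_inf (x : C) : C := Clim (qpoch x p).

(** Increments of the partial products: they turn the infinite product into a series with first term
    1 and a geometrically bounded tail. *)
Let qpoch_diff (x : C) (n : nat) : C :=
  match n with O => 1 | S k => - (x * p ^ k * qpoch x p k) end.

Let sum_qpoch_diff (x : C) (n : nat) : sum_n (qpoch_diff x) n = qpoch x p n.
Proof.
induction n as [|n IH].
- now rewrite sum_O.
- rewrite sum_Sn, IH.
  change (qpoch x p n + - (x * p ^ n * qpoch x p n) = qpoch x p (S n)).
  rewrite qpoch_S. ring.
Qed.

Let qpoch_diff_le (x : C) (n : nat) :
  (Cmod (qpoch_diff x (S n)) <= Cmod x * exp (Cmod x / (1 - r)) * r ^ n)%R.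
Proof.
simpl. rewrite Cmod_opp, !Cmod_mult, Cmod_pow. fold r.
pose proof (Cmod_qpoch_bound x n).
replace (Cmod x * exp (Cmod x / (1 - r)) * r ^ n)%R
  with (Cmod x * r ^ n * exp (Cmod x / (1 - r)))%R by ring.
apply Rmult_le_compat_l; trivial.
apply Rmult_le_pos; [apply Cmod_ge_0 | apply pow_le, Cmod_ge_0].
Qed.

Let is_series_geom_scal (c : R) : is_series (fun n => c * r ^ n)%R (c * / (1 - r))%R.
Proof.
apply (is_series_scal_l (K := R_AbsRing) (V := R_NormedModule) c).
apply is_series_geom. rewrite Rabs_pos_eq; [exact Hp | apply Cmod_ge_0].
Qed.

Lemma is_qpoch_inf_qpoch_inf (x : C) : is_qpoch_inf x p (qpoch_inf x).
Proof.
apply Clim_correct.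
assert (H : ex_series (qpoch_diff x)).
{ apply (ex_series_incr_n _ 1).
  apply (ex_series_Cmod_le _ (fun n => Cmod x * exp (Cmod x / (1 - r)) * r ^ n)%R).
  - exact (qpoch_diff_le x).
  - eexists. apply is_series_geom_scal. }
destruct H as [l Hl]. exists l.
exact (filterlim_ext _ _ (sum_qpoch_diff x) Hl).
Qed.

(** In the series of increments every term after the initial 1 carries a factor [|x|], and the rest
    of its bound is uniform on the disc of radius [R0]. *)
Lemma qpoch_inf_near_0 (R0 : R) :
  exists K, (0 <= K)%R /\
    forall x, (Cmod x <= R0)%R -> (Cmod (qpoch_inf x - 1) <= K * Cmod x)%R.
Proof.
pose proof (Cmod_ge_0 p) as Hp0.
exists (exp (R0 / (1 - r)) * / (1 - r))%R.
assert (Hi : (0 < / (1 - r))%R) by (apply Rinv_0_lt_compat; unfold r; lra).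
split.
- apply Rmult_le_pos; [left; apply exp_pos | lra].
- intros x Hx.
  apply Rle_trans with (Cmod x * exp (Cmod x / (1 - r)) * / (1 - r))%R.
  + apply (is_series_head_Cmod_le (qpoch_diff x)
      (fun n => Cmod x * exp (Cmod x / (1 - r)) * r ^ n)%R).
    * exact (qpoch_diff_le x).
    * exact (filterlim_ext _ _ (fun n => eq_sym (sum_qpoch_diff x n))
        (is_qpoch_inf_qpoch_inf x)).
    * apply is_series_geom_scal.
  + replace (exp (R0 / (1 - r)) * / (1 - r) * Cmod x)%R
      with (Cmod x * exp (R0 / (1 - r)) * / (1 - r))%R by ring.
    apply Rmult_le_compat_r; [lra|].
    apply Rmult_le_compat_l; [apply Cmod_ge_0|].
    apply exp_le, Rmult_le_compat_r; lra.
Qed.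

Lemma qpoch_add (x : C) (n m : nat) :
  qpoch x p (n + m) = qpoch x p n * qpoch (x * p ^ n) p m.
Proof.
induction m as [|m IH].
- rewrite Nat.add_0_r. simpl. ring.
- rewrite Nat.add_succ_r. simpl. rewrite IH, Cpow_add_r. ring.
Qed.

(** Both sides are the limit of [qpoch x p (n + m)] as [m] grows. *)
Lemma qpoch_inf_split (x : C) (n : nat) :
  qpoch_inf x = qpoch x p n * qpoch_inf (x * p ^ n).
Proof.
apply (filterlim_locally_unique (V := C_NormedModule) (F := eventually)
  (fun m => qpoch x p (n + m))).
- apply (filterlim_comp _ _ _ (fun m => (n + m)%nat) (qpoch x p) _ eventually).
  + intros P [N HN]. exists N. intros m Hm. apply HN. lia.
  + apply is_qpoch_inf_qpoch_inf.
- apply (filterlim_ext (fun m => scal (qpoch x p n) (qpoch (x * p ^ n) p m))).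
  + intro m. rewrite qpoch_add. reflexivity.
  + eapply filterlim_comp; [apply is_qpoch_inf_qpoch_inf|].
    exact (filterlim_scal_r (V := C_NormedModule) (qpoch x p n) _).
Qed.

End QPochhammer.

Lemma qpoch_self_neq_0 (q : C) (n : nat) : (Cmod q < 1)%R -> qpoch q q n <> 0.
Proof.
intro Hq. induction n as [|n IH]; simpl.
- apply C1_nz.
- apply Cmult_neq_0; trivial.
  intro E. assert (E1 : q * q ^ n = 1).
  { replace (q * q ^ n) with (1 - (1 - q * q ^ n)) by ring. rewrite E. ring. }
  apply (f_equal Cmod) in E1. rewrite Cmod_1, Cmod_mult, Cmod_pow in E1.
  pose proof (Cmod_ge_0 q).
  assert (Cmod q ^ n <= 1)%R by (rewrite <- (pow1 n); apply pow_incr; lra).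
  assert (0 <= Cmod q ^ n)%R by (now apply pow_le).
  nra.
Qed.

(** * A three-term recursive inequality *)

(** The factors [1 + c r^k] have a bounded product, so smallness of [W] far out propagates back to
    index 0 with a bounded loss, which the weight [e] records. *)
Lemma three_term_null (c r : R) (W : nat -> R) :
  (0 <= c)%R -> (0 <= r < 1)%R -> (forall k, (0 <= W k)%R) ->
  (forall k, (W k <= W (S k) + c * r ^ k * W (S (S k)))%R) ->
  is_lim_seq W 0 -> W 0%nat = 0%R.
Proof.
intros Hc Hr HW Hrec Hlim.
(* [e] is a positive solution of [e (k+1) * (1 + c r^k) <= e k]. *)
set (e := fun k => exp (c * / (1 - r) * r ^ k)).
assert (Hi : (0 < / (1 - r))%R) by (apply Rinv_0_lt_compat; lra).
assert (Hpow : forall k, (0 <= r ^ k)%R) by (intro; apply pow_le; lra).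
assert (Hci : (0 <= c * / (1 - r))%R) by (apply Rmult_le_pos; lra).
assert (He1 : forall k, (1 <= e k)%R).
{ intro k. unfold e. eapply Rle_trans; [|apply exp_ineq1_le].
  generalize (Rmult_le_pos _ _ Hci (Hpow k)). lra. }
assert (HeS : forall k, (e (S k) * (1 + c * r ^ k) <= e k)%R).
{ intro k. unfold e.
  replace (c * / (1 - r) * r ^ k)%R
    with (c * / (1 - r) * r ^ S k + c * r ^ k)%R by (simpl; field; lra).
  rewrite exp_plus. apply Rmult_le_compat_l; [left; apply exp_pos | apply exp_ineq1_le]. }
assert (Hdec : forall k, (e (S k) <= e k)%R).
{ intro k. specialize (HeS k). specialize (He1 (S k)).
  generalize (Rmult_le_pos _ _ Hc (Hpow k)). nra. }
apply Rle_antisym; [|apply HW].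
apply Rnot_lt_le. intro Hpos.
(* Chosen so that [W k <= eps * e k] at [k = 0] reads [W 0 <= W 0 / 2]. *)
set (eps := (W 0%nat / (2 * e 0%nat))%R).
assert (Heps : (0 < eps)%R).
{ apply Rdiv_lt_0_compat; trivial. specialize (He1 0%nat). lra. }
apply is_lim_seq_spec in Hlim. destruct (Hlim (mkposreal eps Heps)) as [N HN].
simpl in HN.
(* Downward induction on [k], with [j] bounding its distance to [N]. Beyond [N], [e k >= 1]
   suffices; in the step, monotonicity of [e] puts both terms over [e (S k)]. *)
assert (H : forall j k, (N <= k + j)%nat -> (W k <= eps * e k)%R).
{ induction j as [|j IH]; intros k Hk.
  - specialize (HN k ltac:(lia)). rewrite Rminus_0_r in HN.
    generalize (Rle_abs (W k)) (He1 k). nra.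
  - eapply Rle_trans; [apply Hrec|].
    pose proof (IH (S k) ltac:(lia)) as H1.
    pose proof (IH (S (S k)) ltac:(lia)) as H2.
    generalize (Rmult_le_pos _ _ Hc (Hpow k)). intro Hck.
    apply Rle_trans with (eps * (e (S k) * (1 + c * r ^ k)))%R.
    + assert (W (S (S k)) <= eps * e (S k))%R.
      { eapply Rle_trans; [exact H2|]. apply Rmult_le_compat_l; [lra|apply Hdec]. }
      generalize (Rmult_le_compat_l _ _ _ Hck H). lra.
    + apply Rmult_le_compat_l; [lra|apply HeS]. }
specialize (H N 0%nat ltac:(lia)). unfold eps in H.
specialize (He1 0%nat).
replace (W 0%nat / (2 * e 0%nat) * e 0%nat)%R with (W 0%nat / 2)%R in H by (field; lra).
lra.
Qed.

(** * The three series as functions of [x]: uniform bounds and behaviour near 0 *)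

Section Identities.

Variable q : C.
Hypothesis Hq : (Cmod q < 1)%R.

Let Hq2 : (Cmod (q ^ 2) < 1)%R.
Proof. rewrite Cmod_pow. pose proof (Cmod_ge_0 q). simpl. nra. Qed.

Let Cmod_pow_q_le_1 (n : nat) : (Cmod (q ^ n) <= 1)%R.
Proof.
rewrite Cmod_pow, <- (pow1 n). apply pow_incr.
split; [apply Cmod_ge_0 | lra].
Qed.

(** A termwise majorant, uniform on a disc, that yields both convergence and a sum tending to 1 as
    [x] tends to 0. The factor [2 ^ n] leaves room for [Cinv_qpoch_le]. *)
Definition tame (R0 : R) (f : C -> nat -> C) : Prop :=
  exists M, (0 <= M)%R /\ forall x, (Cmod x <= R0)%R ->
    (Cmod (f x 0%nat - 1) <= M * Cmod x)%R /\
    forall n, (Cmod (f x n) <= M * (2 * Cmod x) ^ n * Cmod q ^ (n ^ 2))%R.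

Lemma tame_Cseries (R0 : R) (f : C -> nat -> C) : tame R0 f ->
  exists K, forall x, (Cmod x <= R0)%R ->
    is_series (f x) (Cseries (f x)) /\ (Cmod (Cseries (f x) - 1) <= K * Cmod x)%R.
Proof.
intros [M [HM Hf]].
pose proof (Cmod_ge_0 q) as Hq0.
(* Majorant of the tail after one factor [|x|] is taken out; the leading 2 comes from
   [(2 * Cmod x) ^ S n]. [Rabs] keeps the base nonnegative for any [R0]. *)
set (g := fun n => (2 * M * ((2 * Rabs R0) ^ n * Cmod q ^ (n ^ 2)))%R).
assert (Hg : ex_series g).
{ apply (ex_series_scal_l (K := R_AbsRing) (V := R_NormedModule) (2 * M)%R).
  apply ex_series_pow_mul_pow_sqr; [generalize (Rabs_pos R0) |]; lra. }
destruct Hg as [G HG].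
exists (M + G)%R. intros x Hx.
destruct (Hf x Hx) as [H0 Hn].
pose proof (Cmod_ge_0 x) as Hx0.
assert (Htail : forall n, (Cmod (f x (S n)) <= Cmod x * g n)%R).
{ intro n. eapply Rle_trans; [apply Hn|]. unfold g.
  replace (Cmod x * (2 * M * ((2 * Rabs R0) ^ n * Cmod q ^ n ^ 2)))%R
    with (2 * M * Cmod x * ((2 * Rabs R0) ^ n * Cmod q ^ n ^ 2))%R by ring.
  replace (M * (2 * Cmod x) ^ S n * Cmod q ^ S n ^ 2)%R
    with (2 * M * Cmod x * ((2 * Cmod x) ^ n * Cmod q ^ S n ^ 2))%R by (simpl; ring).
  apply Rmult_le_compat_l.
  { apply Rmult_le_pos; lra. }
  apply Rmult_le_compat; try (apply pow_le; lra).
  - apply pow_incr. generalize (Rle_abs R0). lra.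
  - replace (S n ^ 2)%nat with (n ^ 2 + (2 * n + 1))%nat by (simpl; lia).
    rewrite pow_add. rewrite <- (Rmult_1_r (Cmod q ^ n ^ 2)) at 2.
    apply Rmult_le_compat_l; [now apply pow_le|].
    rewrite <- Cmod_pow. apply Cmod_pow_q_le_1. }
assert (HGx : is_series (fun n => Cmod x * g n)%R (Cmod x * G)%R).
{ exact (is_series_scal_l (K := R_AbsRing) (V := R_NormedModule) (Cmod x) g G HG). }
assert (Hs : is_series (f x) (Cseries (f x))).
{ apply Cseries_correct. apply (ex_series_incr_n _ 1).
  apply (ex_series_Cmod_le _ (fun n => Cmod x * g n)%R); [exact Htail|].
  eexists. exact HGx. }
split; trivial.
pose proof (is_series_head_Cmod_le _ _ _ _ Htail Hs HGx).
replace (Cseries (f x) - 1)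
  with ((Cseries (f x) - f x 0%nat) + (f x 0%nat - 1)) by ring.
eapply Rle_trans; [apply Cmod_triangle|]. lra.
Qed.

Definition lhs_term (x : C) (n : nat) : C := x ^ n * q ^ (n ^ 2 + n) / qpoch q q n.

(* For [(i, j) = (2, 2)] and [(1, 3)], the two right-hand sides with their
   infinite product moved inside the sum. *)
Definition rhs_term (i j : nat) (x : C) (n : nat) : C :=
  x ^ n * q ^ (n ^ 2 + i * n) / qpoch (q ^ 2) (q ^ 2) n
    * qpoch_inf (q ^ 2) (- x * q ^ (2 * n + j)).

Let Qn_neq_0 (n : nat) : qpoch (q ^ 2) (q ^ 2) n <> 0.
Proof. now apply qpoch_self_neq_0. Qed.

Let Cmod_term_le (x : C) (n k : nat) (b : C) (M : R) :
  (Cmod b <= M)%R ->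
  (Cmod (x ^ n * q ^ (n ^ 2 + k) * b) <= M * (Cmod x ^ n * Cmod q ^ (n ^ 2)))%R.
Proof.
intro Hb.
rewrite Cpow_add_r, !Cmod_mult, !(Cmod_pow _ n), !(Cmod_pow _ (n ^ 2)).
pose proof (Cmod_pow_q_le_1 k) as Hk.
pose proof (Cmod_ge_0 (q ^ k)). pose proof (Cmod_ge_0 b).
replace (Cmod x ^ n * (Cmod q ^ n ^ 2 * Cmod (q ^ k)) * Cmod b)%R
  with (Cmod (q ^ k) * Cmod b * (Cmod x ^ n * Cmod q ^ n ^ 2))%R by ring.
apply Rmult_le_compat_r.
- apply Rmult_le_pos; apply pow_le, Cmod_ge_0.
- nra.
Qed.

Lemma tame_lhs (R0 : R) : tame R0 lhs_term.
Proof.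
destruct (Cinv_qpoch_le q Hq q) as [M HM].
{ intro n. now apply qpoch_self_neq_0. }
assert (HM0 : (0 <= M)%R).
{ specialize (HM 0%nat). generalize (Cmod_ge_0 (/ qpoch q q 0)). simpl in *. lra. }
exists M. split; trivial. intros x Hx. split.
- unfold lhs_term. simpl. replace (1 * 1 / 1 - 1) with (RtoC 0) by field.
  rewrite Cmod_0. apply Rmult_le_pos; [trivial | apply Cmod_ge_0].
- intro n. unfold lhs_term, Cdiv.
  eapply Rle_trans; [apply (Cmod_term_le x n n _ _ (HM n))|].
  rewrite Rpow_mult_distr. right. ring.
Qed.

Lemma tame_rhs (i j : nat) (R0 : R) : tame R0 (rhs_term i j).
Proof.
destruct (Cinv_qpoch_le (q ^ 2) Hq2 (q ^ 2) Qn_neq_0) as [M HM].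
destruct (qpoch_inf_near_0 (q ^ 2) Hq2 R0) as [K [HK HI]].
assert (HM0 : (0 <= M)%R).
{ specialize (HM 0%nat). generalize (Cmod_ge_0 (/ qpoch (q ^ 2) (q ^ 2) 0)).
  simpl in *. lra. }
assert (HI1 : forall x m, (Cmod x <= R0)%R ->
  (Cmod (qpoch_inf (q ^ 2) (- x * q ^ m) - 1) <= K * Cmod x)%R).
{ intros x m Hx.
  assert (Hm : (Cmod (- x * q ^ m) <= Cmod x)%R).
  { rewrite Cmod_mult, Cmod_opp.
    generalize (Cmod_pow_q_le_1 m) (Cmod_ge_0 x). nra. }
  eapply Rle_trans; [apply HI; lra|]. now apply Rmult_le_compat_l. }
(* The first summand serves the zeroth term, the second the general one, where [1 + K * Rabs R0]
   bounds the infinite product. *)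
exists (K + M * (1 + K * Rabs R0))%R.
assert (HR : (0 <= K * Rabs R0)%R) by (apply Rmult_le_pos; [trivial | apply Rabs_pos]).
assert (HMR : (0 <= M * (1 + K * Rabs R0))%R) by (apply Rmult_le_pos; lra).
split; [lra|].
intros x Hx. pose proof (Cmod_ge_0 x) as Hx0. split.
- eapply Rle_trans; [|apply (Rmult_le_compat_r _ K); lra].
  eapply Rle_trans; [|apply (HI1 x j Hx)].
  right. f_equal. unfold rhs_term. rewrite !Nat.mul_0_r. simpl. field.
- intro n. unfold rhs_term, Cdiv. rewrite <- Cmult_assoc.
  eapply Rle_trans.
  + apply (Cmod_term_le x n (i * n) _ (M * 2 ^ n * (1 + K * Rabs R0))).
    rewrite Cmod_mult.
    apply Rmult_le_compat; trivial; try apply Cmod_ge_0.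
    replace (qpoch_inf (q ^ 2) (- x * q ^ (2 * n + j)))
      with (1 + (qpoch_inf (q ^ 2) (- x * q ^ (2 * n + j)) - 1)) by ring.
    eapply Rle_trans; [apply Cmod_triangle|]. rewrite Cmod_1.
    apply Rplus_le_compat_l. eapply Rle_trans; [now apply HI1|].
    apply Rmult_le_compat_l; trivial. generalize (Rle_abs R0). lra.
  + rewrite Rpow_mult_distr.
    replace (M * 2 ^ n * (1 + K * Rabs R0) * (Cmod x ^ n * Cmod q ^ n ^ 2))%R
      with (M * (1 + K * Rabs R0) * (2 ^ n * Cmod x ^ n * Cmod q ^ n ^ 2))%R by ring.
    rewrite (Rmult_assoc (K + _)). apply Rmult_le_compat_r; [|lra].
    repeat apply Rmult_le_pos; apply pow_le; try apply Cmod_ge_0; lra.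
Qed.

Lemma lhs_series (x : C) : is_series (lhs_term x) (Cseries (lhs_term x)).
Proof.
destruct (tame_Cseries _ _ (tame_lhs (Cmod x))) as [K H]. now apply H, Rle_refl.
Qed.

Lemma rhs_series (i j : nat) (x : C) : is_series (rhs_term i j x) (Cseries (rhs_term i j x)).
Proof.
destruct (tame_Cseries _ _ (tame_rhs i j (Cmod x))) as [K H]. now apply H, Rle_refl.
Qed.

(** * Functional equations relating [x], [x * q] and [x * q ^ 2] *)

(** Passing from [x] to [x * q] multiplies the term of index [n + 1] by [q^(n+1)]; in the
    difference, [1 - q^(n+1)] cancels the last factor of [qpoch q q (S n)]. *)
Lemma lhs_rec (x : C) :
  Cseries (lhs_term x) =
    Cseries (lhs_term (x * q)) + x * q ^ 2 * Cseries (lhs_term (x * q ^ 2)).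
Proof.
apply (is_series_Cplus_Cscal_shift (lhs_term x) (lhs_term (x * q)) (lhs_term (x * q ^ 2)));
  try apply lhs_series; trivial.
intro n. unfold lhs_term.
pose proof (qpoch_self_neq_0 q (S n) Hq) as HS.
pose proof (qpoch_self_neq_0 q n Hq) as H0.
rewrite qpoch_S in HS |- *.
assert (H1 : 1 - q * q ^ n <> 0) by (intro E; apply HS; rewrite E; ring).
replace (S n ^ 2 + S n)%nat with (n ^ 2 + n + n + n + 2)%nat by (simpl; lia).
rewrite !Cpow_mult_l, !Cpow_add_r, (Cpow_S x n), (Cpow_S q n).
replace ((q ^ 2) ^ n) with ((q ^ n) ^ 2) by (rewrite <- !Cpow_mult_r; f_equal; lia).
field. now split.
Qed.

(** Split off the first factor [1 + x q^(2n+2)] of the infinite product: its two summands give the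
    two series on the right, all three products then being the one at [- x * q ^ (2 * n + 4)]. *)
Lemma rhs22_rec (x : C) :
  Cseries (rhs_term 2 2 x) =
    Cseries (rhs_term 1 3 (x * q)) + x * q ^ 2 * Cseries (rhs_term 2 2 (x * q ^ 2)).
Proof.
apply (is_series_Cplus_Cscal (rhs_term 2 2 x) (rhs_term 1 3 (x * q))
  (rhs_term 2 2 (x * q ^ 2))); try apply rhs_series.
intro n. unfold rhs_term.
rewrite (qpoch_inf_split (q ^ 2) Hq2 (- x * q ^ (2 * n + 2)) 1).
replace (- x * q ^ (2 * n + 2) * (q ^ 2) ^ 1) with (- x * q ^ (2 * n + 4))
  by (rewrite !Cpow_add_r; ring).
replace (- (x * q) * q ^ (2 * n + 3)) with (- x * q ^ (2 * n + 4))
  by (rewrite !Cpow_add_r; ring).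
replace (- (x * q ^ 2) * q ^ (2 * n + 2)) with (- x * q ^ (2 * n + 4))
  by (rewrite !Cpow_add_r; ring).
simpl qpoch.
rewrite !Cpow_mult_l, !Cpow_add_r, !(Nat.mul_comm _ n), !Cpow_mult_r.
replace ((q ^ 2) ^ n) with ((q ^ n) ^ 2) by (rewrite <- !Cpow_mult_r; f_equal; lia).
field. apply Qn_neq_0.
Qed.

(** After the shift all three infinite products agree, and [1 - q^(2n+2)] cancels the last factor of
    [qpoch (q ^ 2) (q ^ 2) (S n)]. *)
Lemma rhs13_rec (x : C) :
  Cseries (rhs_term 1 3 x) =
    Cseries (rhs_term 2 2 (x * q)) + x * q ^ 2 * Cseries (rhs_term 1 3 (x * q ^ 2)).
Proof.
apply (is_series_Cplus_Cscal_shift (rhs_term 1 3 x) (rhs_term 2 2 (x * q))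
  (rhs_term 1 3 (x * q ^ 2))); try apply rhs_series.
- unfold rhs_term. simpl. do 2 f_equal. ring.
- intro n. unfold rhs_term.
  replace (- x * q ^ (2 * S n + 3)) with (- x * q ^ (2 * n + 5))
    by (f_equal; f_equal; lia).
  replace (- (x * q) * q ^ (2 * S n + 2)) with (- x * q ^ (2 * n + 5))
    by (replace (2 * S n + 2)%nat with (2 * n + 4)%nat by lia; rewrite !Cpow_add_r; ring).
  replace (- (x * q ^ 2) * q ^ (2 * n + 3)) with (- x * q ^ (2 * n + 5))
    by (rewrite !Cpow_add_r; ring).
  replace (S n ^ 2 + 1 * S n)%nat with (n ^ 2 + n + n + n + 2)%nat by (simpl; lia).
  replace (S n ^ 2 + 2 * S n)%nat with (n ^ 2 + n + n + n + n + 3)%nat by (simpl; lia).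
  rewrite Nat.mul_1_l.
  pose proof (Qn_neq_0 (S n)) as HS. pose proof (Qn_neq_0 n) as H0.
  rewrite qpoch_S in HS |- *.
  assert (H1 : 1 - q ^ 2 * (q ^ 2) ^ n <> 0) by (intro E; apply HS; rewrite E; ring).
  replace ((q ^ 2) ^ n) with ((q ^ n) ^ 2) in *
    by (rewrite <- !Cpow_mult_r; f_equal; lia).
  rewrite !Cpow_mult_l, !Cpow_add_r, (Cpow_S x n), (Cpow_S q n).
  replace ((q ^ 2) ^ n) with ((q ^ n) ^ 2) in *
    by (rewrite <- !Cpow_mult_r; f_equal; lia).
  field. split; trivial.
  intro E. apply H1. rewrite <- E. ring.
Qed.

(** * Equality of the three functions, and the return to the stated series *)

Lemma Cseries_lhs_eq_rhs (a : C) :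
  Cseries (lhs_term a) = Cseries (rhs_term 2 2 a) /\
  Cseries (lhs_term a) = Cseries (rhs_term 1 3 a).
Proof.
destruct (tame_Cseries _ _ (tame_lhs (Cmod a))) as [K1 H1].
destruct (tame_Cseries _ _ (tame_rhs 2 2 (Cmod a))) as [K2 H2].
destruct (tame_Cseries _ _ (tame_rhs 1 3 (Cmod a))) as [K3 H3].
pose proof (Cmod_ge_0 q) as Hq0. pose proof (Cmod_ge_0 a) as Ha0.
set (y := fun k => a * q ^ k).
set (U := fun k => Cseries (lhs_term (y k)) - Cseries (rhs_term 2 2 (y k))).
set (V := fun k => Cseries (lhs_term (y k)) - Cseries (rhs_term 1 3 (y k))).
assert (Hy1 : forall k, y k * q = y (S k)) by (intro k; unfold y; rewrite Cpow_S; ring).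
assert (Hy2 : forall k, y k * q ^ 2 = y (S (S k)))
  by (intro k; unfold y; rewrite !Cpow_S; simpl; ring).
(* The recurrences exchange the two right-hand sides, so [U] and [V] are coupled; only the sum of
   their moduli satisfies a closed inequality. *)
assert (HU : forall k, U k = V (S k) + y k * q ^ 2 * U (S (S k))).
{ intro k. unfold U, V. rewrite (lhs_rec (y k)), (rhs22_rec (y k)), Hy1, Hy2. ring. }
assert (HV : forall k, V k = U (S k) + y k * q ^ 2 * V (S (S k))).
{ intro k. unfold U, V. rewrite (lhs_rec (y k)), (rhs13_rec (y k)), Hy1, Hy2. ring. }
assert (Hyk : forall k, Cmod (y k) = (Cmod a * Cmod q ^ k)%R).
{ intro k. unfold y. now rewrite Cmod_mult, Cmod_pow. }
assert (Hya : forall k, (Cmod (y k) <= Cmod a)%R).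
{ intro k. rewrite Hyk, <- Cmod_pow. generalize (Cmod_pow_q_le_1 k). nra. }
set (W := fun k => (Cmod (U k) + Cmod (V k))%R).
(* Each difference is compared through the common limit 1; the left-hand series occurs in both,
   hence [2 * K1]. *)
assert (HW : forall k, (0 <= W k <= (2 * K1 + K2 + K3) * Cmod a * Cmod q ^ k)%R).
{ intro k. unfold W.
  pose proof (Cmod_ge_0 (U k)). pose proof (Cmod_ge_0 (V k)). split; [lra|].
  destruct (H1 _ (Hya k)) as [_ E1]. destruct (H2 _ (Hya k)) as [_ E2].
  destruct (H3 _ (Hya k)) as [_ E3]. rewrite Hyk in E1, E2, E3.
  assert (EU : (Cmod (U k) <= Cmod (Cseries (lhs_term (y k)) - 1)
      + Cmod (Cseries (rhs_term 2 2 (y k)) - 1))%R).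
  { rewrite <- (Cmod_opp (Cseries (rhs_term 2 2 (y k)) - 1)).
    eapply Rle_trans; [|apply Cmod_triangle]. right. f_equal. unfold U. ring. }
  assert (EV : (Cmod (V k) <= Cmod (Cseries (lhs_term (y k)) - 1)
      + Cmod (Cseries (rhs_term 1 3 (y k)) - 1))%R).
  { rewrite <- (Cmod_opp (Cseries (rhs_term 1 3 (y k)) - 1)).
    eapply Rle_trans; [|apply Cmod_triangle]. right. f_equal. unfold V. ring. }
  lra. }
assert (W0 : W 0%nat = 0%R).
{ apply (three_term_null (Cmod a * Cmod q ^ 2)%R (Cmod q)).
  - apply Rmult_le_pos; [trivial | now apply pow_le].
  - lra.
  - intro k. apply HW.
  - intro k. unfold W. rewrite (HU k), (HV k).
    eapply Rle_trans.
    + apply (Rplus_le_compat _ _ _ _ (Cmod_triangle (V (S k)) _) (Cmod_triangle (U (S k)) _)).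
    + rewrite !Cmod_mult, Hyk, Cmod_pow. right. ring.
  - apply (is_lim_seq_le_le (fun _ => 0%R) _
      (fun k => (2 * K1 + K2 + K3) * Cmod a * Cmod q ^ k)%R);
      [exact HW | apply is_lim_seq_const|].
    replace (Finite 0) with (Rbar_mult ((2 * K1 + K2 + K3) * Cmod a)%R 0)
      by (simpl; f_equal; ring).
    apply is_lim_seq_scal_l, is_lim_seq_geom. rewrite Rabs_pos_eq; lra. }
unfold W in W0.
pose proof (Cmod_ge_0 (U 0%nat)). pose proof (Cmod_ge_0 (V 0%nat)).
assert (U0 : U 0%nat = 0) by (apply Cmod_eq_0; lra).
assert (V0 : V 0%nat = 0) by (apply Cmod_eq_0; lra).
unfold U, V, y in U0, V0. simpl in U0, V0. rewrite Cmult_1_r in U0, V0.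
split.
- replace (Cseries (lhs_term a))
    with (Cseries (lhs_term a) - Cseries (rhs_term 2 2 a) + Cseries (rhs_term 2 2 a))
    by ring.
  rewrite U0. ring.
- replace (Cseries (lhs_term a))
    with (Cseries (lhs_term a) - Cseries (rhs_term 1 3 a) + Cseries (rhs_term 1 3 a))
    by ring.
  rewrite V0. ring.
Qed.

(** By [qpoch_inf_split], the product inside the [n]-th term is the full product divided by the
    nonzero [qpoch (- a * q ^ j) (q ^ 2) n], so the full product is a constant factor. *)
Lemma Cseries_rhs_factor (i j : nat) (a : C) :
  (forall n, qpoch (- a * q ^ j) (q ^ 2) n <> 0) ->
  exists S, is_series (fun n => a ^ n * q ^ (n ^ 2 + i * n) /
      (qpoch (q ^ 2) (q ^ 2) n * qpoch (- a * q ^ j) (q ^ 2) n)) S /\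
    Cseries (rhs_term i j a) = qpoch_inf (q ^ 2) (- a * q ^ j) * S.
Proof.
intro Hn0.
set (f := fun n => a ^ n * q ^ (n ^ 2 + i * n) /
      (qpoch (q ^ 2) (q ^ 2) n * qpoch (- a * q ^ j) (q ^ 2) n)).
destruct (Cinv_qpoch_le (q ^ 2) Hq2 (q ^ 2) Qn_neq_0) as [M1 HM1].
destruct (Cinv_qpoch_le (q ^ 2) Hq2 (- a * q ^ j) Hn0) as [M2 HM2].
assert (Hf : ex_series f).
(* The 4 combines one factor 2 per index from each of the two reciprocals. *)
{ apply (ex_series_Cmod_le _
    (fun n => M1 * M2 * ((4 * Cmod a) ^ n * Cmod q ^ (n ^ 2)))%R).
  - intro n. unfold f, Cdiv.
    eapply Rle_trans; [apply (Cmod_term_le _ _ _ _ (M1 * 2 ^ n * (M2 * 2 ^ n)))|].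
    + replace (/ (_ * _)) with (/ qpoch (q ^ 2) (q ^ 2) n * / qpoch (- a * q ^ j) (q ^ 2) n)
        by (field; split; [apply Hn0 | apply Qn_neq_0]).
      rewrite Cmod_mult. apply Rmult_le_compat; trivial; apply Cmod_ge_0.
    + replace 4%R with (2 * 2)%R by ring. rewrite !Rpow_mult_distr. right. ring.
  - apply (ex_series_scal_l (K := R_AbsRing) (V := R_NormedModule) (M1 * M2)%R).
    pose proof (Cmod_ge_0 q). pose proof (Cmod_ge_0 a).
    apply ex_series_pow_mul_pow_sqr; lra. }
apply Cseries_correct in Hf.
exists (Cseries f). split; trivial.
apply (is_series_unique_C (rhs_term i j a)); [apply rhs_series|].
eapply is_series_ext; [|exact (is_series_scal_l (V := C_NormedModule)
  (qpoch_inf (q ^ 2) (- a * q ^ j)) _ _ Hf)].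
intro n. change (qpoch_inf (q ^ 2) (- a * q ^ j) * f n = rhs_term i j a n).
unfold f, rhs_term.
rewrite (qpoch_inf_split (q ^ 2) Hq2 (- a * q ^ j) n).
replace (- a * q ^ j * (q ^ 2) ^ n) with (- a * q ^ (2 * n + j))
  by (rewrite <- Cpow_mult_r, Cpow_add_r; ring).
field. split; [apply Qn_neq_0 | apply Hn0].
Qed.

(** A vanishing factor of index [n] means [a q^(2(n+1)) = -1], which forces [q <> 0] and makes [a]
    an excluded value. *)
Lemma qpoch_even_neq_0 (a : C) (n : nat) :
  (forall N : nat, (0 < N)%nat -> q <> 0 -> a <> - / q ^ (2 * N)) ->
  qpoch (- a * q ^ 2) (q ^ 2) n <> 0.
Proof.
intro ha. induction n as [|n IH].
- apply C1_nz.
- rewrite qpoch_S. apply Cmult_neq_0; trivial. intro E.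
  assert (E1 : a * q ^ (2 * S n) = - (1)).
  { rewrite Cpow_mult_r, Cpow_S.
    replace (a * _) with ((1 - - a * q ^ 2 * (q ^ 2) ^ n) - 1) by ring.
    rewrite E. ring. }
  assert (Hq0 : q <> 0).
  { intro E0. rewrite E0 in E. apply C1_nz. rewrite <- E. simpl. ring. }
  apply (ha (S n)); [lia | trivial |].
  assert (Hqn : q ^ (2 * S n) <> 0) by now apply Cpow_nz.
  replace a with (a * q ^ (2 * S n) * / q ^ (2 * S n)) by (field; trivial).
  rewrite E1. ring.
Qed.

End Identities.

(** The condition on [a] keeps the denominators of the second series nonzero. Those of the third can
    still vanish, for instance at [a = -q^(-3)], hence its own guard. The premise [q <> 0] reflects
    that [q^(-2N)] has no meaning at [q = 0]. *)
Theorem theorem3 (a q : C) (hq : (Cmod q < 1)%R)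
  (ha : forall N : nat, (0 < N)%nat -> q <> 0 -> a <> - / q ^ (2 * N)) :
  exists S1 : C,
    is_series (fun n : nat => a ^ n * q ^ (n ^ 2 + n) / qpoch q q n) S1 /\
    (exists P2 S2 : C,
        is_qpoch_inf (- a * q ^ 2) (q ^ 2) P2 /\
        is_series (fun n : nat => a ^ n * q ^ (n ^ 2 + 2 * n) /
          (qpoch (q ^ 2) (q ^ 2) n * qpoch (- a * q ^ 2) (q ^ 2) n)) S2 /\
        S1 = P2 * S2) /\
    ((forall n : nat, qpoch (- a * q ^ 3) (q ^ 2) n <> 0) ->
      exists P3 S3 : C,
        is_qpoch_inf (- a * q ^ 3) (q ^ 2) P3 /\
        is_series (fun n : nat => a ^ n * q ^ (n ^ 2 + n) /
          (qpoch (q ^ 2) (q ^ 2) n * qpoch (- a * q ^ 3) (q ^ 2) n)) S3 /\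
        S1 = P3 * S3).
Proof.
assert (hq2 : (Cmod (q ^ 2) < 1)%R).
{ rewrite Cmod_pow. pose proof (Cmod_ge_0 q). simpl. nra. }
destruct (Cseries_lhs_eq_rhs q hq a) as [E2 E3].
eexists. split; [|split].
- exact (lhs_series q hq a).
- destruct (Cseries_rhs_factor q hq 2 2 a) as [S2 [HS2 ES2]].
  { intro n. now apply qpoch_even_neq_0. }
  exists (qpoch_inf (q ^ 2) (- a * q ^ 2)), S2. split; [|split]; trivial.
  + now apply is_qpoch_inf_qpoch_inf.
  + now rewrite <- ES2.
- intro Hn. destruct (Cseries_rhs_factor q hq 1 3 a Hn) as [S3 [HS3 ES3]].
  exists (qpoch_inf (q ^ 2) (- a * q ^ 3)), S3. split; [|split].
  + now apply is_qpoch_inf_qpoch_inf.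
  + eapply is_series_ext; [|exact HS3]. intro n. cbv beta. now rewrite Nat.mul_1_l.
  + now rewrite <- ES3.
Qed.
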